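(* Let $g$ be a polynomial with rational coefficients that is irreducible over $\mathbb{Q}$, has prime degree, has more than one real root, and has at least one non-real root. Then none of the complex roots of $g$ can be obtained on the complex calculator.
   Context: A complex number $x$ can be obtained on the complex calculator if there is a finite sequence of complex numbers ending with $x$, each term of which is either $1$, or the sum, difference, product or quotient (with nonzero divisor) of two earlier terms, or any one of the complex $n$-th roots of an earlier term for some integer $n\ge 2$ (i.e. a complex number whose $n$-th power is an earlier term). *)

(* Defs.v *)
From mathcomp Require Import all_boot all_order all_algebra.
From mathcomp Require Import complex.
From mathcomp Require Import reals.

Set Implicit Arguments.
Unset Strict Implicit.
Unset Printing Implicit Defensive.

Import GRing.Theory Num.Theory.

Local Open Scope ring_scope.

(* An earlier term may be used twice in one arithmetic step. *)
Definition calculator_step (K : fieldType) (t : seq K) (y : K) : Prop :=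
  [\/ y = 1,
      exists a b : K, [/\ a \in t, b \in t &
        [\/ y = a + b, y = a - b, y = a * b | b != 0 /\ y = a / b]]
    | exists (n : nat) (a : K), [/\ (2 <= n)%N, a \in t & y ^+ n = a]].

Definition calculator_sequence (K : fieldType) (s : seq K) : Prop :=
  forall i : nat, (i < size s)%N -> calculator_step (take i s) (nth 0 s i).

Definition calculator_obtainable (K : fieldType) (x : K) : Prop :=
  exists s : seq K, calculator_sequence (rcons s x).

(* Main.v *)
From HB Require Import structures.
Require Import Defs.
From mathcomp Require Import all_boot all_order all_algebra.
From mathcomp Require Import all_fingroup all_solvable all_field.
From mathcomp Require Import boolp.
From mathcomp Require Import complex.
From mathcomp Require Import reals.

Set Implicit Arguments.
Unset Strict Implicit.
Unset Printing Implicit Defensive.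

Import GRing.Theory Num.Theory.

Local Open Scope ring_scope.

(** The proof is by Galois theory, arranged so that neither radical towers nor
    their normal closures ever appear.

    Let a calculator sequence be given that ends with a root x of g.  Choose a
    normal number field L inside the complex numbers that contains all roots of
    g, all radicals taken in the sequence, and a primitive n-th root of unity
    for each exponent n used ([splitting_number_field]).  Put G = Gal(L / Q).
    Every term of the sequence is fixed by some term of the derived series
    of G ([calculator_derived_fix]).  This is clear for sums, products and
    quotients.  For a radical u with u ^ n = a, note that the automorphisms act
    on the n-th roots of unity by powers, so they commute there and the first
    derived subgroup fixes these roots of unity; the automorphisms that fix them
    and a multiply u by roots of unity, so they commute at u and their
    commutators fix u.

    Hence a derived subgroup of G fixes x.  It is normal and G is transitive on
    the roots of g, so it fixes all of them: G acts on the roots as a solvable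
    group, transitively and on a prime number of points.  By a theorem of Galois
    ([solvable_prime_fix2]) an element of such a group with two fixed points is
    trivial.  Complex conjugation restricts to an element of G
    ([gal_of_aut]) and fixes two real roots, so it fixes every root, which is
    absurd for a non-real one. *)

(** * Solvable permutation groups of prime degree *)

Section PrimeDegree.
Local Open Scope group_scope.

(** Point stabilisers have prime index, so they are maximal. *)
Lemma prime_transitive_primitive (aT : finGroupType) (T : finType)
    (to : {action aT &-> T}) (G : {group aT}) :
  prime #|T| -> [transitive G, on setT | to] -> [primitive G, on setT | to].
Proof.
move=> prT trG; have [x _] : exists x : T, x \in T.
  by apply/card_gt0P/prime_gt0.
rewrite (trans_prim_astab (in_setT x) trG).
apply/maximal_eqP; split=> [|H sCH sHG]; first exact: subsetIl.
have /maxgroupP[_ maxC] : maximal 'C_G[x | to] G.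
  apply: p_index_maximal; first exact: subsetIl.
  by rewrite -card_orbit (atransP trG) ?inE // cardsT.
have [->|neHG] := eqVneq (H : {set aT}) G; first by right.
by left; apply: maxC; rewrite // properEneq neHG.
Qed.

(** A minimal normal subgroup A is abelian by solvability and transitive by
    primitivity, hence regular of prime order and generated by the element a
    that moves x to y.  As c fixes x and y, the conjugate a ^ c also moves x to
    y, so it equals a: thus c commutes with a, and it fixes the whole orbit of x
    under a. *)
Lemma solvable_prime_fix2 (T : finType) (G : {group {perm T}}) (c : {perm T})
    (x y : T) :
  prime #|T| -> [transitive G, on setT | 'P] -> solvable G -> c \in G ->
  x != y -> c x = x -> c y = y -> c = 1.
Proof.
move=> prT trG solG Gc neq_xy cx cy.
have [-> //|ntc] := eqVneq c 1.
have ntG : G :!=: 1 by apply: contraNneq ntc => G1; rewrite G1 inE in Gc.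
have [A minA sAG] : {A : {group {perm T}} | minnormal A G & A \subset G}.
  by apply: mingroup_exists; rewrite ntG normG.
have [_ ntA /is_abelemP[p _ /abelem_abelian abA]] :=
  minnormal_solvable minA sAG solG.
have nAG : G \subset 'N(A) by case/mingroupP: minA => /andP[].
have trA : [transitive A, on setT | 'P].
  have nsAG : A <| G by rewrite /normal sAG.
  have := prim_trans_norm (prime_transitive_primitive prT trG) nsAG.
  case=> // /subsetIP[_ sAC]; case/negP: ntA.
  rewrite -subG1; apply: subset_trans sAC _; apply/subsetP=> b /astabP fixb.
  by rewrite inE; apply/eqP/permP=> z; rewrite perm1; apply: fixb.
have regA u v b : u \in A -> v \in A -> u b = v b -> u = v.
  move=> Au Av eq_uv; apply/permP=> z.
  have [w Aw ->] := atransP2 trA (in_setT b) (in_setT z).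
  rewrite /= /aperm -!permM -(centsP abA u Au w Aw) -(centsP abA v Av w Aw).
  by rewrite !permM eq_uv.
have oA : #|A| = #|T|.
  rewrite -cardsT -(atransP trA x (in_setT x)) card_orbit.
  suffices -> : 'C_A[x | 'P] = 1 by rewrite indexg1.
  apply/trivgP/subsetP=> b /setIP[Ab /astab1P bx]; rewrite inE.
  by apply/eqP/(regA _ _ x); rewrite ?group1 // perm1.
have [a Aa y_ax] := atransP2 trA (in_setT x) (in_setT y).
rewrite /= /aperm in y_ax.
have a_neq1 : a != 1 by apply: contraNneq neq_xy => a1; rewrite y_ax a1 perm1.
have oa : #[a] = #|T|.
  apply/(prime_nt_dvdP prT); first by rewrite order_eq1.
  by rewrite -oA order_dvdG.
have Aac : a ^ c \in A by rewrite memJ_norm // (subsetP nAG).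
have cac : a ^ c = a.
  apply/(regA _ _ x) => //.
  have cVx : c^-1 x = x by rewrite -{1}cx permK.
  by rewrite /conjg !permM cVx -y_ax cy.
have /commgP cac' : [~ a, c] == 1 by apply/conjg_fixP.
apply/permP=> z; rewrite perm1.
have tr_a := perm_prime_atrans prT oa.
have [b /cycleP[i def_b] ->] := atransP2 tr_a (in_setT x) (in_setT z).
rewrite {}def_b.
have cai : c * a ^+ i = a ^+ i * c := commuteX i (commute_sym cac').
by rewrite /= /aperm -permM -cai permM cx.
Qed.

(** Normality and transitivity spread the fixed point t to all points, so the
    group of permutations induced by G is solvable. *)
Lemma derived_prime_fix2 (gT : finGroupType) (T : finType)
    (to : {action gT &-> T}) (G : {group gT}) (k : nat) (c : gT) (t x y : T) :
  prime #|T| -> [transitive G, on setT | to] -> G^`(k) \subset 'C[t | to] ->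
  c \in G -> x != y -> to x c = x -> to y c = y -> forall z, to z c = z.
Proof.
move=> prT trG fixGt Gc neq_xy cx cy z.
have fixGk : G^`(k) \subset 'C(setT | to).
  apply/subsetP=> b Gkb; apply/astabP=> u _.
  have [h Gh ->] := atransP2 trG (in_setT t) (in_setT u).
  rewrite actCJV [to t (b ^ _)](astab1P _) //.
  rewrite (subsetP fixGt) // memJ_norm ?groupV //.
  by rewrite (subsetP (normal_norm (der_normal k G))) ?groupV.
rewrite -[LHS](actpermE to c z).
suffices -> : actperm to c = 1 by rewrite perm1.
apply: (@solvable_prime_fix2 _ (actperm_morphism to @* G) _ x y) => //.
- apply/imsetP; exists x; rewrite ?inE //; apply/setP=> u; rewrite inE.
  have [b Gb ->] := atransP2 trG (in_setT x) (in_setT u).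
  apply/esym/imsetP; exists (actperm to b); first by rewrite mem_morphim ?inE.
  by rewrite /= /aperm actpermE.
- apply/derivedP; exists k; rewrite -morphim_der ?subsetT //.
  apply/trivgP/subsetP=> _ /morphimP[b _ /(subsetP fixGk) /astabP fixb ->].
  by rewrite inE; apply/eqP/permP=> u; rewrite actpermE perm1 fixb ?inE.
- by rewrite mem_morphim ?inE.
- by rewrite actpermE.
- by rewrite actpermE.
Qed.

End PrimeDegree.

(** * Normal number fields inside the complex numbers *)

Lemma seq_preimage (T U : eqType) (f : T -> U) (s : seq U) :
  (forall y, y \in s -> exists x, f x = y) -> exists r, map f r = s.
Proof.
elim: s => [|y s IHs] f_onto; first by exists nil.
have [|r <-] := IHs; first by move=> w s_w; apply: f_onto; rewrite inE s_w orbT.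
by have [x <-] := f_onto y (mem_head y s); exists (x :: r).
Qed.

Section NumberFields.
Variable C : numClosedFieldType.
Local Notation algebraic := (algebraicOver (@ratr C)).
Local Notation pQtoC := (map_poly (@ratr C)).

Lemma closed_prim_root n : (0 < n)%N -> exists z : C, n.-primitive_root z.
Proof.
move=> n_gt0; have [r Dp] := closed_field_poly_normal ('X^n - 1 : {poly C}).
rewrite (monicP _) ?monicXnsubC // scale1r in Dp.
have rn1 : all n.-unity_root r by apply/allP=> z; rewrite -root_prod_XsubC -Dp.
have sz_r : (n < (size r).+1)%N.
  by rewrite -(size_prod_XsubC r id) -Dp size_XnsubC.
have [|z] := hasP (has_prim_root n_gt0 rn1 _ sz_r); last by exists z.
by rewrite -separable_prod_XsubC -Dp separable_Xn_sub_1 // pnatr_eq0 -lt0n.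
Qed.

Lemma algebraic_root n (x : C) : (0 < n)%N -> algebraic (x ^+ n) -> algebraic x.
Proof.
move=> n_gt0 [p nz_p px0]; exists (p \Po 'X^n).
  rewrite comp_poly_eq0 // size_polyXn ltnS //.
by rewrite /root map_comp_poly map_polyXn horner_comp hornerXn.
Qed.

Lemma algebraic_irreducible (x : C) :
  algebraic x -> exists2 p : {poly rat}, irreducible_poly p & root (pQtoC p) x.
Proof.
move=> [p nz_p px0].
pose P n := `[< exists q : {poly rat},
                  [/\ q != 0, root (pQtoC q) x & size q = n] >].
have exP : exists n, P n by exists (size p); apply/asboolP; exists p.
have [n /asboolP[q [nz_q qx0 <-]] min_q] := ex_minnP exP.
exists q => //; apply/(subfx_irreducibleP qx0 nz_q) => r rx0 nz_r.
by apply: min_q; apply/asboolP; exists r.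
Qed.

(** The last clause puts z in the additive group generated by s.  It makes Q(z)
    no larger than Q(s), which is what normality requires when s lists the roots
    of a polynomial. *)
Lemma primitive_element (s : seq C) :
  (forall x, x \in s -> algebraic x) ->
  exists z, [/\ algebraic z,
    forall x, x \in s -> exists p, (pQtoC p).[z] = x &
    forall E : C -> Prop, E 0 -> (forall x y, E x -> E y -> E (x - y)) ->
      (forall x, x \in s -> E x) -> E z].
Proof.
elim: s => [|x s IHs] alg_s.
  exists 0; split=> //; exact: (algebraic0 (@ratr C)).
have [|z [alg_z gen_s z_s]] := IHs.
  by move=> y s_y; apply: alg_s; rewrite inE s_y orbT.
have alg_x : algebraic x by apply: alg_s; rewrite mem_head.
have [[pz nz_pz pz0] [px nz_px px0]] := (alg_z, alg_x).
have [n /= [[qz Dz] [qx Dx]]] := pchar0_PET nz_pz pz0 nz_px px0 (pchar_num _).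
exists (x *+ n - z); split=> [|y|E E0 EB Es].
- apply: (algebraic_sub _ alg_z); rewrite -mulr_natr.
  by apply: algebraic_mul alg_x _; rewrite -(ratr_nat C); apply: algebraic_id.
- rewrite inE => /predU1P[-> | /gen_s[p <-]]; first by exists qx.
  by exists (p \Po qz); rewrite map_comp_poly horner_comp Dz.
- apply: (EB); last by apply: z_s => // y s_y; apply: Es; rewrite inE s_y orbT.
  have Ex : E x by apply: Es; rewrite mem_head.
  have EN y : E y -> E (- y) by rewrite -[- y]sub0r; apply: EB.
  elim: n {Dz Dx} => [|n En] //; rewrite mulrSr -[x in _ + x]opprK.
  by apply/EB/EN.
Qed.

Lemma map_ratr_in_alg (L : fieldExtType rat) (i : {rmorphism L -> C}) p :
  map_poly i (map_poly (in_alg L) p) = pQtoC p.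
Proof.
rewrite -map_poly_comp; apply: eq_map_poly => a /=.
by rewrite alg_num_field fmorph_rat.
Qed.

(** The field is Q(rs), for rs the list of complex roots of a rational
    polynomial P that vanishes on s; it is realised as Q(z) for a primitive
    element z. *)
Lemma splitting_number_field (s : seq C) :
  (forall x, x \in s -> algebraic x) ->
  exists (L : splittingFieldType rat) (i : {rmorphism L -> C}),
    forall x, x \in s -> exists u, i u = x.
Proof.
move=> alg_s.
have [P nz_P Ps] : exists2 P : {poly rat}, P != 0
    & forall x, x \in s -> root (pQtoC P) x.
  elim: s alg_s => [|x s IHs] alg_s; first by exists 1; rewrite ?oner_eq0.
  have [|P nz_P Ps] := IHs.
    by move=> y s_y; apply: alg_s; rewrite inE s_y orbT.
  have [p nz_p px0] := alg_s x (mem_head x s).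
  exists (p * P); first by rewrite mulf_neq0.
  move=> y; rewrite inE rmorphM rootM => /predU1P[->|/Ps->].
    by rewrite px0.
  by rewrite orbT.
have [rs Drs] := closed_field_poly_normal (pQtoC P).
have nz_lP : lead_coef (pQtoC P) != 0 by rewrite lead_coef_eq0 map_poly_eq0.
have Proots x : root (pQtoC P) x = (x \in rs).
  by rewrite Drs rootZ // root_prod_XsubC.
have [|z [alg_z gen_rs z_rs]] := @primitive_element rs.
  by move=> x rs_x; exists P; rewrite // Proots.
have [r irr_r rz0] := algebraic_irreducible alg_z.
have nz_r : r != 0 by rewrite -size_poly_gt0 ltnW // irr_r.1.
pose L := SubFieldExtType rz0 irr_r.
pose i : {rmorphism L -> C} := @subfx_inj _ _ (@ratr C) z r.
have gen_L x : x \in rs -> exists u, i u = x.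
  move=> /gen_rs[p <-]; exists (subfx_eval (@ratr C) z r p).
  exact: subfx_inj_eval.
have [rs1 Drs1] := seq_preimage gen_L.
have splitL : splitting_field_axiom L.
  exists (map_poly (in_alg L) P); first by apply/polyOver1P; exists P.
  exists rs1.
    rewrite -(eqp_map i) map_ratr_in_alg rmorph_prod Drs -Drs1 big_map.
    under [X in _ %= X]eq_bigr do rewrite /= map_polyXsubC.
    by rewrite eqp_scale.
  apply/vspaceP=> x; rewrite memvf.
  have [q ->] := subfxEroot rz0 nz_r x.
  rewrite rpred_horner //.
    by apply: (polyOverSv (sub1v _)); apply/polyOver1P; exists q.
  (* The generator is the preimage of z, which lies in <<1 & rs1>> because
     z is in the additive group generated by rs. *)
  pose E y := exists2 u, u \in <<1 & rs1>>%VS & i u = y.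
  have [||y rs_y|u Eu] := z_rs E.
  - by exists 0; rewrite ?rmorph0 ?mem0v.
  - by move=> _ _ [u Eu <-] [v Ev <-]; exists (u - v); rewrite ?rmorphB ?rpredB.
  - move: rs_y; rewrite -Drs1 => /mapP[u rs_u ->]; exists u => //.
    exact: seqv_sub_adjoin.
  move=> Diu; suffices -> : subfx_root (@ratr C) z r = u :> L by [].
  by apply: (fmorph_inj i); rewrite Diu; apply: subfx_inj_root.
(* The splitting structure is added to an abstract field K, whose canonical
   structures are found by inference, rather than to the explicit L. *)
suffices packL (K : fieldExtType rat) (j : {rmorphism K -> C}) :
    splitting_field_axiom K ->
  exists (K' : splittingFieldType rat) (j' : {rmorphism K' -> C}),
    forall u, exists v, j' v = j u.
  have [K [j Dj]] := packL L i splitL; exists K, j => x s_x.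
  have [u <-] : exists u, i u = x by apply: gen_L; rewrite -Proots; apply: Ps.
  exact: Dj.
move=> splitK.
pose K' : splittingFieldType rat :=
  HB.pack (FieldExt.sort K) (FieldExt_isSplittingField.Build rat K splitK).
by exists K', j => u; exists u.
Qed.

(** A complex automorphism fixes the rational numbers, so it permutes the roots
    of each minimal polynomial over Q; by normality these roots lie in L. *)
Lemma gal_of_aut (L : splittingFieldType rat) (i : {rmorphism L -> C})
    (nu : {rmorphism C -> C}) :
  exists2 c : gal_of {:L}, c \in 'Gal({:L} / 1)%g &
    forall u, i (c u) = nu (i u).
Proof.
have ex_nu u : exists v, i v == nu (i u).
  have [rs /eqP Hrs] := splitting_field_normal 1%AS u.
  have /polyOver1P[p Dp] : minPoly 1 u \is a polyOver 1%VS.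
    exact: minPolyOver.
  have : root (pQtoC p) (nu (i u)).
    have <- : map_poly nu (pQtoC p) = pQtoC p.
      by rewrite -map_poly_comp; apply: eq_map_poly => a; rewrite /= fmorph_rat.
    by rewrite -(map_ratr_in_alg i) -Dp !fmorph_root root_minPoly.
  rewrite -(map_ratr_in_alg i) -Dp Hrs rmorph_prod /=.
  under eq_bigr do rewrite map_polyXsubC.
  by rewrite -(big_map i xpredT (fun x => 'X - x%:P)) root_prod_XsubC
    => /mapP[v _ ->]; exists v.
pose nu0 u := xchoose (ex_nu u).
have Dnu0 u : i (nu0 u) = nu (i u) by apply/eqP/(xchooseP (ex_nu u)).
have nu0a : zmod_morphism nu0.
  by move=> x y; apply: (fmorph_inj i); rewrite !(Dnu0, rmorphB).
have nu0m : monoid_morphism nu0.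
  split=> [|x y]; apply: (fmorph_inj i); rewrite ?Dnu0 ?rmorph1 //.
  by rewrite !rmorphM /= !Dnu0.
pose nu0aM := GRing.isZmodMorphism.Build L L nu0 nu0a.
pose nu0mM := GRing.isMonoidMorphism.Build L L nu0 nu0m.
pose nu0RM : {rmorphism _ -> _} := HB.pack nu0 nu0aM nu0mM.
pose nu0lM := GRing.isScalable.Build rat L L *:%R nu0 (fmorph_numZ nu0RM).
pose nu0L : {linear _ -> _} := HB.pack nu0 nu0aM nu0lM.
have nu0_hom : kHom 1 {:L} (linfun nu0L).
  apply/kHom_monoid_morphism; split=> [|x y]; rewrite !lfunE /=.
    exact: nu0m.1.
  exact: nu0m.2.
have [|c galc Dc] := @kAut_to_gal _ L 1%AS {:L}%AS (linfun nu0L).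
  by rewrite kAutfE.
by exists c => // u; rewrite -Dc ?memvf // lfunE /= Dnu0.
Qed.

End NumberFields.

(** * Elements fixed by derived subgroups *)

Section DerivedFix.
Variable (F : fieldType) (L : splittingFieldType F).
Implicit Types (A : {group gal_of {:L}}) (u v w : L).

(** The hypothesis concerns the whole orbit of u because
    [~ r, s] u = (r * s) ((s * r)^-1 u): the products r * s and s * r are
    compared at the point (s * r)^-1 u of that orbit. *)
Lemma derived1_fix A u :
  (forall r s t, r \in A -> s \in A -> t \in A -> s (r (t u)) = r (s (t u))) ->
  forall s, s \in A^`(1)%g -> s u = u.
Proof.
move=> commA.
have fixE (s : gal_of {:L}) : (s \in 'Gal({:L} / <<1; u>>)%g) = (s u == u).
  rewrite gal_kHom ?subvf //; apply/kAHomP/eqP => [fix_s | su v].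
    exact/fix_s/memv_adjoin.
  case/Fadjoin_polyP=> p /polyOver1P[q ->] ->.
  by rewrite -horner_map /= su -map_poly_comp (eq_map_poly (rmorph_alg s)).
have sub : (A^`(1) \subset 'Gal({:L} / <<1; u>>))%g.
  rewrite derg1 gen_subG; apply/subsetP=> _ /imset2P[r s Ar As ->].
  have Art : ((s * r)^-1 \in A)%g by rewrite groupV groupM.
  rewrite fixE; apply/eqP.
  have -> : ([~ r, s] = (s * r)^-1 * (r * s))%g.
    by rewrite commgEl invMg conjgE !mulgA.
  rewrite !galM ?memvf // commA //.
  by rewrite -galM ?memvf // -galM ?memvf // mulVg gal_id.
by move=> s /(subsetP sub); rewrite fixE => /eqP.
Qed.

(** Automorphisms act on the powers of z by raising to powers, so they commute
    there. *)
Lemma derived1_fix_unity_root n z :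
  n.-primitive_root z ->
  forall s : gal_of {:L}, s \in ('Gal({:L} / 1))^`(1)%g -> s z = z.
Proof.
move=> prim_z; apply: derived1_fix => r s t _ _ _.
have powz (g : gal_of {:L}) : exists i, g z = z ^+ i.
  by have [i _ ->] := aut_prim_rootP g prim_z; exists i.
have [[[i ri] [j sj]] [k tk]] := (powz r, powz s, powz t).
rewrite tk !rmorphXn /= ri sj !rmorphXn /= ri sj -!exprM.
by rewrite !mulnA [(i * j)%N]mulnC.
Qed.

(** Each element of A multiplies u by a power of z, and it fixes that power, so
    A commutes on the orbit of u. *)
Lemma derived1_fix_radical A n z u :
  n.-primitive_root z -> (forall s, s \in A -> s z = z) ->
  (forall s, s \in A -> s (u ^+ n) = u ^+ n) ->
  forall s, s \in A^`(1)%g -> s u = u.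
Proof.
move=> prim_z fixz fixa; apply: derived1_fix => r s t Ar As At.
have powz (g : gal_of {:L}) : g \in A -> exists i, g u = z ^+ i * u.
  move=> Ag; have [u0|nz_u] := eqVneq u 0.
    by exists 0%N; rewrite u0 rmorph0 mulr0.
  have [|i Di] := prim_rootP prim_z (x := g u / u).
    by rewrite expr_div_n -rmorphXn /= fixa // divff // expf_neq0.
  by exists i; rewrite -Di divfK.
have [[[i ri] [j sj]] [k tk]] := (powz r Ar, powz s As, powz t At).
rewrite tk !rmorphM !rmorphXn /= !fixz // ri sj !rmorphM !rmorphXn /= !fixz //.
by rewrite ri sj; congr (_ * _); rewrite mulrCA.
Qed.

End DerivedFix.

Section Calculator.
Variable C : numClosedFieldType.
Local Notation algebraic := (algebraicOver (@ratr C)).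

(** The list S collects the radicals and the roots of unity that L has to
    contain.  A radical costs two steps of the derived series: one makes sure
    that the subgroup lies in the first derived subgroup, which fixes the roots
    of unity, and the commutators of the next step fix the radical. *)
Lemma calculator_derived_fix (s : seq C) :
  calculator_sequence s ->
  (forall x, x \in s -> algebraic x) /\
  exists2 S : seq C, (forall x, x \in S -> algebraic x) &
    forall (L : splittingFieldType rat) (i : {rmorphism L -> C}),
      (forall x, x \in S -> exists u, i u = x) ->
    exists k, forall x, x \in s -> exists2 u, i u = x &
      forall c : gal_of {:L}, c \in ('Gal({:L} / 1))^`(k)%g -> c u = u.
Proof.
elim/last_ind: s => [_|s x IHs calc_s].
  by split=> //; exists nil => // L i _; exists 0%N.
have calc_x : calculator_step s x.
  have := calc_s (size s); rewrite size_rcons ltnSn => /(_ isT).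
  by rewrite -cats1 take_size_cat // nth_cat ltnn subnn.
have [|alg_s [S alg_S fix_s]] := IHs.
  move=> j lt_j; have := calc_s j.
  rewrite size_rcons ltnS (ltnW lt_j) => /(_ isT).
  by rewrite -cats1 take_cat nth_cat lt_j.
case: calc_x => [->|[a [b [s_a s_b Dx]]]|[n [a [n_gt1 s_a Dx]]]].
- split=> [y|].
    rewrite mem_rcons inE => /predU1P[->|/alg_s //]; exact: algebraic1.
  exists S => // L i /fix_s[k fix_k]; exists k => y.
  rewrite mem_rcons inE => /predU1P[->|/fix_k //].
  by exists 1 => [|c _]; rewrite rmorph1.
- have [alg_a alg_b] := (alg_s a s_a, alg_s b s_b).
  split=> [y|].
    rewrite mem_rcons inE => /predU1P[->|/alg_s //].
    case: Dx => [-> | -> | -> | [_ ->]].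
    + exact: algebraic_add.
    + exact: algebraic_sub.
    + exact: algebraic_mul.
    + exact: algebraic_div.
  exists S => // L i /fix_s[k fix_k]; exists k => y.
  rewrite mem_rcons inE => /predU1P[->|/fix_k //].
  have [u Du fix_u] := fix_k a s_a; have [v Dv fix_v] := fix_k b s_b.
  case: Dx => [-> | -> | -> | [_ ->]].
  + by exists (u + v) => [|c Gc]; rewrite rmorphD /= ?Du ?Dv ?fix_u ?fix_v.
  + by exists (u - v) => [|c Gc]; rewrite rmorphB /= ?Du ?Dv ?fix_u ?fix_v.
  + by exists (u * v) => [|c Gc]; rewrite rmorphM /= ?Du ?Dv ?fix_u ?fix_v.
  + by exists (u / v) => [|c Gc]; rewrite fmorph_div /= ?Du ?Dv ?fix_u ?fix_v.
have n_gt0 : (0 < n)%N by apply: ltnW.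
have alg_x : algebraic x.
  by apply: (algebraic_root n_gt0); rewrite Dx; apply: alg_s.
have [z prim_z] := closed_prim_root C n_gt0.
have alg_z : algebraic z.
  apply: (algebraic_root n_gt0); rewrite (prim_expr_order prim_z).
  exact: algebraic1.
split=> [y|]; first by rewrite mem_rcons inE => /predU1P[->|/alg_s].
exists (x :: z :: S) => [y|L i memL].
  by rewrite !inE => /or3P[/eqP->|/eqP->|/alg_S].
have [|k fix_k] := fix_s L i.
  by move=> y S_y; apply: memL; rewrite !inE S_y !orbT.
have [u Du] := memL x (mem_head _ _).
have [w Dw] : exists w, i w = z by apply: memL; rewrite !inE eqxx orbT.
have prim_w : n.-primitive_root w by rewrite -(fmorph_primitive_root i) Dw.
exists k.+2 => y; rewrite mem_rcons inE => /predU1P[->|/fix_k[v Dv fix_v]].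
  exists u => //.
  apply: (derived1_fix_radical (A := (('Gal({:L} / 1))^`(k.+1))%G)).
  - exact: prim_w.
  - move=> c Gc; apply: (derived1_fix_unity_root prim_w).
    by apply: subsetP Gc; rewrite !dergSn commgSS ?der_sub.
  - have [v Dv fix_v] := fix_k a s_a.
    have -> : u ^+ n = v by apply: (fmorph_inj i); rewrite rmorphXn /= Du Dv.
    by move=> c Gc; apply: fix_v; apply: subsetP Gc; apply: der_subS.
exists v => // c Gc; apply/fix_v/(subsetP (der_subS k _)).
exact: subsetP (der_subS k.+1 _) c Gc.
Qed.
End Calculator.

(** * The Galois action on the roots *)

Lemma irreducible_separable (F : numFieldType) (p : {poly F}) :
  irreducible_poly p -> separable_poly p.
Proof.
move=> irr_p; rewrite unlock irreducible_poly_coprime //.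
have p_gt1 := irr_p.1; have nz_p : p != 0 by rewrite -size_poly_gt0 ltnW.
have nz_dp : p^`() != 0.
  apply: contraNneq nz_p => dp0; rewrite -lead_coef_eq0 lead_coefE.
  have -> : (size p).-1 = (size p).-2.+1 by rewrite prednK ?ltn_predRL.
  have /esym/eqP := coef_deriv p (size p).-2.
  by rewrite dp0 coef0 mulrn_eq0.
by apply/negP=> /(dvdp_leq nz_dp); rewrite leqNgt lt_size_deriv.
Qed.

Lemma gal_root_action (F : fieldType) (L : splittingFieldType F) (rs : seq L) :
    (forall (c : gal_of {:L}) u, u \in rs -> c u \in rs) ->
  exists to : {action gal_of {:L} &-> seq_sub rs},
    forall x c, val (to x c) = c (val x).
Proof.
move=> rs_gal.
pose to (x : seq_sub rs) (c : gal_of {:L}) := SeqSub (rs_gal c _ (valP x)).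
have to1 x : to x 1%g = x by apply: val_inj; rewrite /= gal_id.
have toM x : act_morph to x.
  by move=> c d; apply: val_inj; rewrite /= galM ?memvf.
by exists (TotalAction to1 toM).
Qed.

(** The theorem of Galois transported to the roots of g.  The roots are
    distinct because g is separable, so they are as many as the degree; the
    group is transitive because g is associate to the minimal polynomial of any
    of its roots. *)
Lemma galois_prime_fix2 (L : splittingFieldType rat) (g : {poly rat}) rs k
    (c : gal_of {:L}) (t u v : L) :
  let gL := map_poly (in_alg L) g in
  irreducible_poly g -> prime (size g).-1 ->
  gL %= \prod_(w <- rs) ('X - w%:P) ->
  t \in rs -> (forall s, s \in ('Gal({:L} / 1))^`(k)%g -> s t = t) ->
  c \in 'Gal({:L} / 1)%g -> u \in rs -> v \in rs -> u != v ->
  c u = u -> c v = v ->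
  forall w, w \in rs -> c w = w.
Proof.
move=> gL irr_g pr_g splitL rs_t fix_t Gc rs_u rs_v neq_uv cu cv w rs_w.
have rootE a : root gL a = (a \in rs).
  by rewrite (eqp_root splitL) root_prod_XsubC.
have gL_s (s : gal_of {:L}) : map_poly s gL = gL.
  by rewrite -map_poly_comp; apply: eq_map_poly => a; apply: rmorph_alg.
have [|to toE] := @gal_root_action _ L rs.
  by move=> s a; rewrite -!rootE -{2}(gL_s s) fmorph_root.
have uniq_rs : uniq rs.
  rewrite -separable_prod_XsubC -(eqp_separable splitL) separable_map.
  exact: irreducible_separable.
have oT : #|{: seq_sub rs}| = (size g).-1.
  rewrite card_seq_sub // -[size rs]/((size rs).+1.-1).
  by rewrite -(size_prod_XsubC rs id) -(eqp_size splitL) size_map_poly.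
have trG : [transitive 'Gal({:L} / 1), on setT | to].
  apply/imsetP; exists (SeqSub rs_t); rewrite ?inE //.
  apply/setP=> x; rewrite inE.
  have /polyOver1P[m Dm] : minPoly 1 t \is a polyOver 1%VS.
    exact: minPolyOver.
  have m_g : m %= g.
    apply: irr_g.2.
      by rewrite -(size_map_poly (in_alg L)) -Dm size_minPoly.
    rewrite -(dvdp_map (in_alg L)) -Dm minPoly_dvdp ?rootE //.
    by apply/polyOver1P; exists g.
  have [||||s Gs Ds] := @normalField_root_minPoly _ L 1%AS {:L}%AS t (val x).
  - exact: subvf.
  - exact: normalFieldf.
  - exact: memvf.
  - have /eqp_root -> : minPoly 1 t %= gL by rewrite Dm eqp_map.
    by rewrite rootE; apply: valP.
  by apply/esym/imsetP; exists s => //; apply: val_inj; rewrite toE.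
have fix2 := @derived_prime_fix2 _ _ to ('Gal({:L} / 1))%G k c
  (SeqSub rs_t) (SeqSub rs_u) (SeqSub rs_v).
rewrite -[w]/(val (SeqSub rs_w)) -toE fix2 // ?oT //.
- apply/subsetP=> s Gs; apply/astab1P; apply: val_inj.
  by rewrite toE; apply: fix_t.
- by apply: val_inj; rewrite toE.
- by apply: val_inj; rewrite toE.
Qed.

Lemma prime_degree_unobtainable (C : numClosedFieldType) (g : {poly rat})
  (g_irr : irreducible_poly g)
  (g_deg : prime (size g).-1)
  (g_real : exists x y : C,
     [/\ x != y, x \is Num.real, y \is Num.real,
         root (map_poly ratr g) x & root (map_poly ratr g) y])
  (g_nonreal : exists z : C,
     z \isn't Num.real /\ root (map_poly ratr g) z) :
  forall x : C,
    root (map_poly ratr g) x -> ~ calculator_obtainable x.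
Proof.
move=> x gx0 [s /calculator_derived_fix[_ [S alg_S fix_S]]].
have [a [b [neq_ab Ra Rb ga0 gb0]]] := g_real; have [z [nRz gz0]] := g_nonreal.
have nz_g : g != 0 by rewrite -size_poly_gt0 ltnW // g_irr.1.
have [rs Drs] := closed_field_poly_normal (map_poly (@ratr C) g).
have nz_lg : lead_coef (map_poly (@ratr C) g) != 0.
  by rewrite lead_coef_eq0 map_poly_eq0.
have rootE y : root (map_poly ratr g) y = (y \in rs).
  by rewrite Drs rootZ // root_prod_XsubC.
have [|L [i memL]] := @splitting_number_field C (rs ++ S).
  move=> y; rewrite mem_cat => /orP[|/alg_S //]; rewrite -rootE.
  by exists g.
have [|k fix_k] := fix_S L i.
  by move=> y S_y; apply: memL; rewrite mem_cat S_y orbT.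
have [t Dt fix_t] : exists2 u, i u = x &
    forall c : gal_of {:L}, c \in ('Gal({:L} / 1))^`(k)%g -> c u = u.
  by apply: fix_k; rewrite mem_rcons mem_head.
have [|rs1 Drs1] := @seq_preimage _ _ i rs.
  by move=> y rs_y; apply: memL; rewrite mem_cat rs_y.
have memrs1 u : (u \in rs1) = root (map_poly ratr g) (i u).
  by rewrite rootE -Drs1 mem_map //; apply: fmorph_inj.
have split1 : map_poly (in_alg L) g %= \prod_(w <- rs1) ('X - w%:P).
  rewrite -(eqp_map i) map_ratr_in_alg rmorph_prod Drs -Drs1 big_map.
  under [X in _ %= X]eq_bigr do rewrite /= map_polyXsubC.
  by rewrite eqp_scale.
have liftL y : root (map_poly ratr g) y -> exists2 u, i u = y & u \in rs1.
  rewrite rootE -Drs1 => /mapP[u rs_u ->]; by exists u.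
have [c Gc Dc] := gal_of_aut i (@Num.conj C).
have [[ua Da rs_a] [ub Db rs_b]] := (liftL a ga0, liftL b gb0).
have [w Dw rs_w] := liftL z gz0.
case/negP: nRz; apply/CrealP; rewrite -Dw -Dc; congr (i _).
apply: (galois_prime_fix2 g_irr g_deg split1 _ fix_t Gc rs_a rs_b) => //.
- by rewrite memrs1 Dt.
- by apply: contraNneq neq_ab => ab; rewrite -Da -Db ab.
- by apply: (fmorph_inj i); rewrite Dc Da; apply: conj_Creal.
- by apply: (fmorph_inj i); rewrite Dc Db; apply: conj_Creal.
Qed.

Theorem mainTheorem4 (R : realType) (g : {poly rat})
  (g_irr : irreducible_poly g)
  (g_deg : prime (size g).-1)
  (g_real : exists x y : complex R,
     [/\ x != y, x \is Num.real, y \is Num.real,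
         root (map_poly ratr g) x & root (map_poly ratr g) y])
  (g_nonreal : exists z : complex R,
     z \isn't Num.real /\ root (map_poly ratr g) z) :
  forall x : complex R,
    root (map_poly ratr g) x -> ~ calculator_obtainable x.
Proof. exact: (@prime_degree_unobtainable (complex R)). Qed.
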